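(* Let $p\ge5$ be a prime with $p\equiv 1\pmod 3$. Let $J\in\mathbb{F}_p$ with $J\neq\pm2,-1$ and $J^2\neq 4/3$, and assume $\dfrac{J+1}{J-2}=T^3$ for some $T\in\mathbb{F}_p^*$. Put $C=3J^2-4$, $D=9J^3-36J-28$. Then the Vieta graph of the cubic $x^2+y^2+z^2=xyz-C(x+y+z)+D$ over $\mathbb{F}_p$ has $p^2+1+4\sigma(1-4T^3)p$ vertices in total, of which $3\big(p-6+2\sigma(T^4-T)A_3(p)\big)$ are deficient; there are $3\big(p-9+2\sigma(T^4-T)A_3(p)\big)$ vertices of degree $2$, $9$ vertices of degree $1$, and $0$ vertices of degree $0$.
   Context: $\sigma:\mathbb{F}_p\to\{-1,0,1\}\subset\mathbb{Z}$ denotes the quadratic character: $\sigma(a)=1$ if $a$ is a nonzero square, $\sigma(a)=-1$ if $a$ is a non-square, $\sigma(0)=0$. For a prime $p\equiv1\pmod 3$, $A_3(p)$ is the integer $A$ determined by writing $p=A^2+3B^2$ with $A,B\in\mathbb{Z}$ and $A\equiv-1\pmod 3$. The Vieta graph of the equation $x^2+y^2+z^2=xyz-C(x+y+z)+D$ over $\mathbb{F}_p$ is the finite simple graph whose vertices are the solutions $(x,y,z)\in\mathbb{F}_p^3$, where two distinct vertices are joined by an edge whenever one is a Vieta flip of the other. The Vieta flips of $(x,y,z)$ are $(yz-C-x,y,z)$, $(x,xz-C-y,z)$, $(x,y,xy-C-z)$. Every vertex has degree at most $3$; a vertex is deficient if its degree is less than $3$. *)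

(* Defs.v *)
From HB Require Import structures.
From mathcomp Require Import all_boot all_order all_algebra.
From Stdlib Require Import ClassicalEpsilon.

Set Implicit Arguments.
Unset Strict Implicit.
Unset Printing Implicit Defensive.

Import Order.TTheory GRing.Theory Num.Theory.
Local Open Scope ring_scope.

Definition sigma (F : finFieldType) (a : F) : int :=
  if a == 0 then 0 else if [exists b : F, b ^+ 2 == a] then 1 else -1.

Definition A3_spec (p : nat) (A : int) : Prop :=
  (exists B : int, p%:Z = A ^+ 2 + 3 * B ^+ 2) /\ (A = -1 %[mod 3])%Z.

(* For a prime p = 1 %[mod 3] there is exactly one integer satisfying
   A3_spec p, so the choice made by epsilon is then forced. *)
Definition A3 (p : nat) : int := epsilon (inhabits 0) (A3_spec p).

Section VietaGraph.
Variables (F : finFieldType) (C D : F).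

Definition vieta_cubic (v : F * F * F) : bool :=
  let: (x, y, z) := v in
  x ^+ 2 + y ^+ 2 + z ^+ 2 == x * y * z - C * (x + y + z) + D.

Definition vieta_flips (v : F * F * F) : seq (F * F * F) :=
  let: (x, y, z) := v in
  [:: (y * z - C - x, y, z); (x, x * z - C - y, z); (x, y, x * y - C - z)].

Definition vieta_vertices : {set F * F * F} := [set v | vieta_cubic v].

Definition vieta_edge : rel (F * F * F) := fun v w =>
  [&& v \in vieta_vertices, w \in vieta_vertices, v != w
    & (w \in vieta_flips v) || (v \in vieta_flips w)].

Lemma vieta_edge_sym : symmetric vieta_edge.
Proof.
by move=> v w; rewrite /vieta_edge andbCA eq_sym [(w \in vieta_flips v) || _]orbC.
Qed.

Lemma vieta_edge_irr : irreflexive vieta_edge.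
Proof. by move=> v; rewrite /vieta_edge eqxx /= !andbF. Qed.

Definition vieta_degree (v : F * F * F) : nat := #|[set w | vieta_edge v w]|.

Definition vieta_deficient : {set F * F * F} :=
  [set v in vieta_vertices | (vieta_degree v < 3)%N].

Definition vieta_of_degree (d : nat) : {set F * F * F} :=
  [set v in vieta_vertices | vieta_degree v == d].

End VietaGraph.

(* Main.v *)
(** The three flips move different coordinates, so the degree of a vertex is
    3 minus the number of coordinates fixed by their flip.  All counts then
    reduce to sums of the quadratic character [sigma].

    Fixing one coordinate [x] leaves a conic whose discriminant in the remaining
    coordinate is, up to a square, [(x + 2) * f x] for the cubic
    [f x = (x - 2) * (x^2 + C x - D) + C^2].  The number of vertices is governed
    by the roots of [f], the number of vertices with a fixed coordinate by the
    sum of [sigma ((x + 2) * f x)], and the vertices at which two given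
    coordinates are fixed are in bijection with the roots of [f].

    With [t = T^3], [(t - 1) * f] is [t (x + 2)^3 - (x + 2 + m)^3], so under the
    substitution [x = -2 + m / (w - 1)] the roots of [f] become the cube roots of
    [t] and the character sum becomes that of [w^3 + 1].  The latter is
    [2 A_3(p)]: for a primitive root [z], the sums [a], [b], [c] of
    [sigma (x^3 + 1)], [sigma (z x^3 + 1)], [sigma (z^2 x^3 + 1)] satisfy
    [a + b + c = 0] and [a^2 + b^2 + c^2 = 6 p], that is
    [(a / 2)^2 + 3 ((a / 2 + b) / 3)^2 = p], where [a] is even and 1 mod 3. *)
Require Import Defs.
From mathcomp Require Import all_boot all_order all_algebra all_solvable all_field.
From mathcomp Require Import ring zify.
From Stdlib Require Import ClassicalEpsilon.
Import Order.TTheory GRing.Theory Num.Theory.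
Set Implicit Arguments.
Unset Strict Implicit.
Unset Printing Implicit Defensive.
Local Open Scope ring_scope.

Lemma card_sum_int (T : finType) (P : pred T) :
  #|[set x | P x]|%:Z = \sum_x (P x)%:R :> int.
Proof.
rewrite -sum1_card -natz natr_sum big_mkcond /=.
by apply: eq_bigr => x _; rewrite inE; case: (P x).
Qed.

(** * The quadratic character of a finite field of odd order, and its sums over polynomials of
    degree at most two *)

Section QuadraticCharacter.
Variable F : finFieldType.
Local Notation q := #|F|.
Local Notation s := (@sigma F).

Lemma card_gt1 : (1 < q)%N.
Proof. exact: finNzRing_gt1. Qed.

Lemma primitive_root_exists : exists z : F, q.-1.-primitive_root z.
Proof.
have q1 := card_gt1; have n_gt0 : (0 < q.-1)%N by rewrite -subn1 subn_gt0.
pose rs := enum (predC1 (0 : F)).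
have szrs : size rs = q.-1 by rewrite -cardE cardC1.
have rs_root : all q.-1.-unity_root rs.
  apply/allP => x; rewrite mem_enum unity_rootE => /= x0.
  have xU : x \is a GRing.unit by rewrite unitfE.
  by rewrite -(inj_eq (mulIf x0)) mul1r -exprSr prednK ?expf_card // ltnW.
have /hasP[z _ zP] := has_prim_root n_gt0 rs_root (enum_uniq _) (eq_leq (esym szrs)).
by exists z.
Qed.

Lemma primitive_root_neq0 (z : F) : q.-1.-primitive_root z -> z != 0.
Proof.
move=> zP; apply/eqP=> z0; have := prim_expr_order zP.
rewrite z0 expr0n (gtn_eqF (prim_order_gt0 zP)) => /eqP.
by rewrite eq_sym oner_eq0.
Qed.

Lemma sum_nonzero_primitive (z : F) (V : nmodType) (h : F -> V) :
  q.-1.-primitive_root z ->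
  \sum_(x | x != 0) h x = \sum_(0 <= k < q.-1) h (z ^+ k).
Proof.
move=> zP; rewrite big_mkord.
pose e (k : 'I_q.-1) := z ^+ k.
have e_inj : injective e.
  by move=> i j /eqP; rewrite (eq_prim_root_expr zP) !modn_small // => /eqP/val_inj.
have z0 := primitive_root_neq0 zP.
rewrite -(big_imset h (in2W e_inj)) /=; apply: eq_bigl => x.
suff -> : [set e k | k : 'I_q.-1] = [set~ 0] by rewrite !inE.
apply/eqP; rewrite eqEcard cardsC1 card_imset // card_ord leqnn andbT.
by apply/subsetP => _ /imsetP[k _ ->]; rewrite !inE expf_neq0.
Qed.

Lemma sigma0 : s 0 = 0. Proof. by rewrite /sigma eqxx. Qed.

Lemma sigma_sqr (a : F) : a != 0 -> s (a ^+ 2) = 1.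
Proof.
rewrite /sigma expf_eq0 /= => /negPf->.
by case: existsP => // -[]; exists a.
Qed.

Lemma sigma1 : s 1 = 1.
Proof. by rewrite -(sigma_sqr (oner_neq0 F)) expr1n. Qed.

Lemma nonzero_primitive (z : F) (x : F) :
  q.-1.-primitive_root z -> x != 0 -> exists k, x = z ^+ k.
Proof.
move=> zP x0; have [|k ->] := prim_rootP zP (x := x); last by exists k.
have xU : x \is a GRing.unit by rewrite unitfE.
have q1 := card_gt1.
by apply: (mulIf x0); rewrite mul1r -exprSr prednK ?expf_card // ltnW.
Qed.

Hypothesis q_odd : odd q.

(** If 2 = 0 then -1 = 1, and the half power of a primitive root, being a square root of 1, would be
    1 itself, against the order of the root. *)
Lemma two_neq0 : (2 : F) != 0.
Proof.
have q1 := card_gt1.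
have [z zP] := primitive_root_exists.
have h2 : q.-1 = (q.-1)./2.*2.
  by rewrite -[LHS]odd_double_half; move: q_odd q1; case: q => //= n /negPf->.
have : (z ^+ (q.-1)./2) ^+ 2 == 1 by rewrite -exprM muln2 -h2 prim_expr_order.
rewrite sqrf_eq1 => /orP[|/eqP e].
  rewrite -(prim_order_dvd zP) => /dvdn_leq; move: h2 q1; lia.
apply/eqP => e2.
have /eqP : z ^+ (q.-1)./2 = 1.
  by rewrite e; apply/eqP; rewrite -subr_eq0 -opprD oppr_eq0; apply/eqP.
rewrite -(prim_order_dvd zP) => /dvdn_leq; move: h2 q1; lia.
Qed.

Lemma four_neq0 : (4 : F) != 0.
Proof. by rewrite (_ : 4 = 2 * 2 :> F) ?mulf_neq0 ?two_neq0 //; ring. Qed.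

(** As q - 1 is even, the parity of an exponent of [z] is well defined, and the nonzero squares are
    exactly the even powers. *)
Lemma sigma_primitive (z : F) k : q.-1.-primitive_root z ->
  s (z ^+ k) = (-1) ^+ k.
Proof.
move=> zP.
have z0 := primitive_root_neq0 zP.
have q1 := card_gt1.
rewrite /sigma expf_eq0 (negPf z0) andbF -signr_odd.
case: existsP => [[b /eqP bk]|nb]; last first.
  suff -> : odd k by [].
  apply/negPn/negP => ek; apply: nb; exists (z ^+ k./2).
  by rewrite -exprM muln2 -[in X in _ == X](odd_double_half k) (negPf ek).
suff -> : odd k = false by [].
have b0 : b != 0 by rewrite -sqrf_eq0 bk expf_neq0.
have [j bj] := nonzero_primitive zP b0.
move: bk; rewrite bj -exprM => /eqP; rewrite (eq_prim_root_expr zP) => /eqP e.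
have e2 : (2 %| q.-1)%N by rewrite dvdn2; move: q_odd q1; case: q.
have : (j * 2 = k %[mod 2])%N by rewrite -(modn_dvdm _ e2) e modn_dvdm.
by rewrite modnMl modn2; case: (odd k).
Qed.

Lemma sigmaM (a b : F) : s (a * b) = s a * s b.
Proof.
have [z zP] := primitive_root_exists.
have [->|/(nonzero_primitive zP)[i ->]] := eqVneq a 0.
  by rewrite mul0r sigma0 mul0r.
have [->|/(nonzero_primitive zP)[j ->]] := eqVneq b 0.
  by rewrite mulr0 sigma0 mulr0.
by rewrite -exprD !sigma_primitive // exprD.
Qed.

Lemma sigma_sqrM (a b : F) : a != 0 -> s (a ^+ 2 * b) = s b.
Proof. by move=> a0; rewrite sigmaM sigma_sqr ?mul1r. Qed.

Lemma sqr_sigma (a : F) : s a ^+ 2 = (a != 0)%:R.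
Proof.
by rewrite /sigma; case: eqP => //= _; case: ifP => _; rewrite ?sqrrN expr1n.
Qed.

(** Scaling the variable by a primitive root, a non-square, changes the sign of every term. *)
Lemma sum_sigma : \sum_x s x = 0.
Proof.
have [z zP] := primitive_root_exists.
have z0 := primitive_root_neq0 zP.
have : \sum_x s x = - \sum_x s x.
  rewrite {1}(reindex_inj (mulfI z0)) /= -sumrN; apply: eq_bigr => x _.
  by rewrite sigmaM -[X in s X]expr1 sigma_primitive // mulN1r.
lia.
Qed.

Lemma sum_sigma_linear (a b : F) : a != 0 -> \sum_x s (a * x + b) = 0.
Proof.
move=> a0; rewrite -[RHS]sum_sigma [RHS](reindex_inj (addIr b)) /=.
by rewrite [RHS](reindex_inj (mulfI a0)).
Qed.

Lemma sum_sqr_eq (a : F) : \sum_x (x ^+ 2 == a)%:R = 1 + s a.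
Proof.
rewrite /sigma; case: eqVneq => [->|a0].
  rewrite (bigD1 0) //= expr0n eqxx big1 ?addr0 // => x /negPf x0.
  by rewrite expf_eq0 x0.
case: existsP => [[b /eqP ba]|nb]; last first.
  by rewrite big1 // => x _; case: eqP => // e; case: nb; exists x; rewrite e.
have b0 : b != 0 by rewrite -sqrf_eq0 ba.
have bN : - b != b.
  rewrite -subr_eq0 -opprD oppr_eq0 -mulr2n -mulr_natl mulf_neq0 //.
  exact: two_neq0.
rewrite (bigD1 b) //= ba eqxx (bigD1 (- b)) //= sqrrN ba eqxx big1 ?addr0 //.
by move=> x /andP[/negPf xb /negPf xNb]; rewrite -ba eqf_sqr xb xNb.
Qed.

Lemma sum_comp_sqr (g : F -> int) : \sum_x g (x ^+ 2) = \sum_v (1 + s v) * g v.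
Proof.
transitivity (\sum_x \sum_v (x ^+ 2 == v)%:R * g v).
  apply: eq_bigr => x _; rewrite (bigD1 (x ^+ 2)) //= eqxx mul1r big1 ?addr0 //.
  by move=> v; rewrite eq_sym => /negPf->; rewrite mul0r.
by rewrite exchange_big; apply: eq_bigr => v _; rewrite -mulr_suml sum_sqr_eq.
Qed.

Lemma sum_sigma_sqrB (d : F) : \sum_u s (u ^+ 2 - d) = -1 + q%:Z * (d == 0)%:R.
Proof.
case: eqVneq => [->|d0].
  rewrite (bigD1 0) //= subr0 expr0n sigma0 add0r.
  rewrite (eq_bigr (fun=> 1)) => [|x x0]; last by rewrite subr0 sigma_sqr.
  rewrite sumr_const cardC1 mulr1 natz; have := card_gt1; case: q => // n _; lia.
rewrite (sum_comp_sqr (fun v => s (v - d))) mulr0 addr0.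
under eq_bigr => v _ do rewrite mulrDl mul1r -sigmaM.
rewrite big_split /= -[X in X + _]/(\sum_v s (v - d)).
have -> : \sum_v s (v - d) = 0.
  by rewrite -[RHS]sum_sigma [RHS](reindex_inj (addIr (- d))).
rewrite add0r (bigD1 0) //= mul0r sigma0 add0r.
(* Put w = 1/i: i (i - d) is i^2 times 1 - d/i, and the square factor drops out. *)
have e : \sum_(i | i != 0) s (i * (i - d)) = \sum_(w | w != 0) s (1 - d * w).
  rewrite [RHS](reindex_inj invr_inj) /=; apply: eq_big => [x|x x0].
    by rewrite invr_eq0.
  by rewrite -(sigma_sqrM (1 - d / x) x0); congr s; field.
rewrite e; have Nd0 : - d != 0 by rewrite oppr_eq0.
have := sum_sigma_linear 1 Nd0; rewrite (bigD1 0) //= mulr0 add0r.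
rewrite sigma1 => e2.
suff -> : \sum_(w | w != 0) s (1 - d * w) = \sum_(w | w != 0) s (- d * w + 1).
  by move/eqP: e2; rewrite addrC addr_eq0 => /eqP->.
by apply: eq_bigr => w _; congr s; ring.
Qed.

Lemma affine_bij (a b : F) : a != 0 -> injective (fun x : F => a * x + b).
Proof. by move=> a0 x y /addIr /(mulfI a0). Qed.

(** Completing the square: (2 a)^2 times the polynomial is a ((2 a x + b)^2 - (b^2 - 4 a c)). *)
Lemma sum_sigma_quadratic (a b c : F) : a != 0 ->
  \sum_x s (a * x ^+ 2 + b * x + c)
  = s a * (-1 + q%:Z * (b ^+ 2 - 4 * a * c == 0)%:R).
Proof.
move=> a0; rewrite -sum_sigma_sqrB mulr_sumr.
have a2 : 2 * a != 0 by rewrite mulf_neq0 ?two_neq0.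
rewrite [RHS](reindex_inj (@affine_bij (2 * a) b a2)) /=.
apply: eq_bigr => x _.
by rewrite -(sigma_sqrM _ a2) -sigmaM; congr s; ring.
Qed.

Lemma sum_quadratic_eq0 (a b c : F) : a != 0 ->
  \sum_x (a * x ^+ 2 + b * x + c == 0)%:R = 1 + s (b ^+ 2 - 4 * a * c).
Proof.
move=> a0; rewrite -sum_sqr_eq.
have a2 : 2 * a != 0 by rewrite mulf_neq0 ?two_neq0.
have a4 : 4 * a != 0 by rewrite mulf_neq0 ?four_neq0.
rewrite [RHS](reindex_inj (@affine_bij (2 * a) b a2)) /=.
apply: eq_bigr => x _; rewrite -[in RHS]subr_eq0.
have -> : (2 * a * x + b) ^+ 2 - (b ^+ 2 - 4 * a * c)
   = 4 * a * (a * x ^+ 2 + b * x + c) by ring.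
by rewrite mulf_eq0 (negPf a4).
Qed.

Lemma sum_linear_eq0 (a b : F) : a != 0 -> \sum_x (a * x + b == 0)%:R = 1 :> int.
Proof.
move=> a0; transitivity (\sum_y (y == (0 : F))%:R : int).
  by rewrite [RHS](reindex_inj (@affine_bij a b a0)).
by rewrite (bigD1 0) //= eqxx big1 // => x /negPf->.
Qed.
End QuadraticCharacter.

(** * The sums of the character over c x^3 + 1: first and second moments in c *)

Section CubicSums.
Variable F : finFieldType.
Local Notation q := #|F|.
Local Notation s := (@sigma F).
Hypothesis q_odd : odd q.
Hypothesis q_mod3 : (3 %| q.-1)%N.

(** For x = z^k the three arguments are z^(3k), z^(3k+1), z^(3k+2), so the exponents run through 3
    (q - 1) consecutive integers, which are three full periods of [z]. *)
Lemma sum_over_cubes (z : F) (g : F -> int) : q.-1.-primitive_root z ->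
  \sum_x (g (x ^+ 3) + g (z * x ^+ 3) + g (z ^+ 2 * x ^+ 3)) = 3 * \sum_u g u.
Proof.
move=> zP; rewrite (bigD1 0) //= [in RHS](bigD1 0) //= expr0n !mulr0 mulrDr.
rewrite !(sum_nonzero_primitive _ zP); congr (_ + _); first by rewrite /=; ring.
transitivity (\sum_(0 <= m < q.-1 * 3) g (z ^+ m)).
  rewrite big_nat_mul; apply: eq_bigr => k _.
  rewrite mulSn -{1}[(k * 3)%N]add0n big_addn addnK.
  rewrite !big_nat_recr //= big_geq // add0r add0n -exprM -exprS -exprD.
  by congr (g (z ^+ _) + g (z ^+ _) + g (z ^+ _)); lia.
have e i : \sum_(i * q.-1 <= j < i.+1 * q.-1) g (z ^+ j) = \sum_(0 <= k < q.-1) g (z ^+ k).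
  rewrite mulSn -{1}[(i * q.-1)%N]add0n big_addn addnK.
  by apply: eq_bigr => k _; rewrite exprD mulnC exprM (prim_expr_order zP) expr1n mulr1.
rewrite mulnC big_nat_mul (eq_bigr _ (fun i _ => e i)) sumr_const_nat.
by rewrite subn0 -[LHS]mulr_natl.
Qed.

Lemma cube_root_unity_exists : exists w : F, w ^+ 2 + w + 1 = 0.
Proof.
have [z zP] := primitive_root_exists F.
have h : (q.-1 %/ 3 * 3 = q.-1)%N by rewrite divnK.
exists (z ^+ (q.-1 %/ 3)); set w := z ^+ _.
have w1 : w - 1 != 0.
  rewrite subr_eq0 /w -(prim_order_dvd zP); apply/negP => /dvdn_leq.
  by have := prim_order_gt0 zP; lia.
apply: (mulfI w1); rewrite mulr0.
have : w ^+ 3 = 1 by rewrite /w -exprM h prim_expr_order.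
move=> w3; transitivity (w ^+ 3 - 1); [ring | by rewrite w3 subrr].
Qed.

Variable w : F.
Hypothesis wE : w ^+ 2 + w + 1 = 0.

Lemma cube_root_unity_cubed : w ^+ 3 = 1.
Proof.
apply/eqP; rewrite -subr_eq0; apply/eqP.
by transitivity ((w - 1) * (w ^+ 2 + w + 1)); [ring | rewrite wE mulr0].
Qed.

Lemma cube_root_unity_neq0 : w != 0.
Proof. by apply/eqP=> w0; move/eqP: wE; rewrite w0 expr0n !add0r oner_eq0. Qed.

(** In characteristic 3 one has (v - 1)^3 = v^3 - 1, which would force an element of order 3 to be
    1. *)
Lemma three_neq0 : (3 : F) != 0.
Proof.
have [z zP] := primitive_root_exists F.
have h : (q.-1 %/ 3 * 3 = q.-1)%N by rewrite divnK.
apply/eqP => e3; set v := z ^+ (q.-1 %/ 3).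
have v3 : v ^+ 3 = 1 by rewrite /v -exprM h prim_expr_order.
have : (v - 1) ^+ 3 == 0.
  rewrite (_ : _ ^+ 3 = v ^+ 3 - 1 - 3 * (v ^+ 2 - v)); last by ring.
  by rewrite v3 e3 mul0r subrr subr0.
rewrite expf_eq0 /= subr_eq0 /v -(prim_order_dvd zP) => /dvdn_leq.
by have := prim_order_gt0 zP; lia.
Qed.

Lemma cube_root_unity_neq1 : w != 1.
Proof.
apply/eqP => w1; have := three_neq0.
suff -> : 3 = w ^+ 2 + w + 1 by rewrite wE eqxx.
by rewrite w1; ring.
Qed.

(** From w^3 = 1, w = w^4 is a square. *)
Lemma sigma_cube_root_unity : s w = 1.
Proof.
rewrite -(mulr1 w) -cube_root_unity_cubed -exprS (exprM w 2 2).
by rewrite sigma_sqr // expf_neq0 // cube_root_unity_neq0.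
Qed.

Lemma cube_eqE (x y : F) : (y ^+ 3 == x ^+ 3) = [|| y == x, y == x * w | y == x * w ^+ 2].
Proof.
rewrite -subr_eq0.
have -> : y ^+ 3 - x ^+ 3 = (y - x) * ((y - x * w) * (y - x * w ^+ 2)).
  have -> : w ^+ 2 = - w - 1 by apply/eqP; rewrite -subr_eq0 -wE; apply/eqP; ring.
  have w2 : w * w = - w - 1 by apply/eqP; rewrite -subr_eq0 -wE; apply/eqP; ring.
  ring: w2.
by rewrite !mulf_eq0 !subr_eq0.
Qed.

Lemma sum_cube_eq (x : F) (h : F -> int) : x != 0 ->
  \sum_y (y ^+ 3 == x ^+ 3)%:R * h y = h x + h (x * w) + h (x * w ^+ 2).
Proof.
move=> x0; have w1 := cube_root_unity_neq1; have w0 := cube_root_unity_neq0.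
have e1 : x * w != x by rewrite -{2}[x]mulr1 (inj_eq (mulfI x0)).
have e2 : x * w ^+ 2 != x.
  rewrite -{2}[x]mulr1 (inj_eq (mulfI x0)) sqrf_eq1 (negPf w1) /=.
  by apply/eqP=> e; move/eqP: wE; rewrite e sqrrN expr1n subrK oner_eq0.
have e3 : x * w ^+ 2 != x * w.
  by rewrite (inj_eq (mulfI x0)) expr2 -{3}[w]mulr1 (inj_eq (mulfI w0)).
rewrite (bigD1 x) //= (bigD1 (x * w)) ?e1 //= (bigD1 (x * w ^+ 2)) ?e2 ?e3 //=.
rewrite !cube_eqE !eqxx !orbT !mul1r big1 ?addr0 ?addrA // => y.
by rewrite cube_eqE => /andP[/andP[/negPf-> /negPf->] /negPf->]; rewrite mul0r.
Qed.

(** For c nonzero this is minus the Frobenius trace of the elliptic curve y^2 = c x^3 + 1. By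
    [cubic_sumM] it then depends only on the class of c modulo cubes. *)
Definition cubic_sum (c : F) : int := \sum_x s (c * x ^+ 3 + 1).

Lemma cubic_sum0 : cubic_sum 0 = q%:Z.
Proof.
rewrite /cubic_sum; under eq_bigr => x _ do rewrite mul0r add0r sigma1.
by rewrite sumr_const natz.
Qed.

Lemma cubic_sumM (c x : F) : x != 0 -> cubic_sum (c * x ^+ 3) = cubic_sum c.
Proof.
move=> x0; rewrite /cubic_sum [in RHS](reindex_inj (mulfI x0)) /=.
by apply: eq_bigr => y _; congr s; ring.
Qed.

(** Together the three classes modulo cubes cover the field three times, and the sum of s (u + 1)
    over all u vanishes. *)
Lemma cubic_sum_add3 (z : F) : q.-1.-primitive_root z ->
  cubic_sum 1 + cubic_sum z + cubic_sum (z ^+ 2) = 0.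
Proof.
move=> zP; rewrite /cubic_sum -!big_split /=.
under eq_bigr => x _ do rewrite mul1r.
rewrite (sum_over_cubes (fun u => s (u + 1)) zP).
suff -> : \sum_u s (u + 1) = 0 by rewrite mulr0.
rewrite -[RHS](sum_sigma_linear q_odd 1 (oner_neq0 F)).
by apply: eq_bigr => x _; rewrite mul1r.
Qed.

(** For x, y nonzero the product is a quadratic in c with leading coefficient (x y)^3 and
    discriminant (y^3 - x^3)^2, so only pairs with equal cubes contribute a multiple of q. *)
Lemma sum_sigma_two_cubics (x y : F) :
  \sum_c s (c * x ^+ 3 + 1) * s (c * y ^+ 3 + 1)
  = s x * s y * (-1 + q%:Z * (y ^+ 3 == x ^+ 3)%:R) + q%:Z * ((x == 0) && (y == 0))%:R.
Proof.
have s1 := sigma1 F.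
have lin (u : F) : u != 0 -> \sum_c s (c * u ^+ 3 + 1) = 0.
  move=> u0; under eq_bigr => c _ do rewrite mulrC.
  by rewrite sum_sigma_linear // expf_neq0.
case: (eqVneq x 0) => [->|x0]; case: (eqVneq y 0) => [->|y0] /=;
  rewrite ?sigma0 // ?mul0r ?mulr0 ?mul0r ?add0r ?mulr0 ?addr0 ?mulr1.
- under eq_bigr => c _ do rewrite expr0n mulr0 add0r s1.
  by rewrite sumr_const natz.
- under eq_bigr => c _ do rewrite expr0n mulr0 add0r s1 mul1r.
  exact: lin.
- under eq_bigr => c _ do rewrite expr0n mulr0 add0r s1 mulr1.
  exact: lin.
have xy0 : x * y != 0 by rewrite mulf_neq0.
transitivity (\sum_c s ((x * y) ^+ 3 * c ^+ 2 + (x ^+ 3 + y ^+ 3) * c + 1)).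
  by apply: eq_bigr => c _; rewrite -sigmaM //; congr s; ring.
rewrite sum_sigma_quadratic ?expf_neq0 // exprSr sigma_sqrM // sigmaM //.
congr (_ * (_ + _ * (nat_of_bool _)%:R)).
rewrite (_ : _ - _ = (y ^+ 3 - x ^+ 3) ^+ 2); last by ring.
by rewrite expf_eq0 subr_eq0.
Qed.

(** Expand the square and sum over c first. Each x != 0 meets three y with the same cube, all with s
    y = s x because s w = 1, and so contributes 3 q; x = 0 contributes q. *)
Lemma sum_sqr_cubic_sum : \sum_c cubic_sum c ^+ 2 = q%:Z + 3 * q%:Z * (q%:Z - 1).
Proof.
transitivity (\sum_x \sum_y \sum_c s (c * x ^+ 3 + 1) * s (c * y ^+ 3 + 1)).
  under eq_bigr => c _ do rewrite expr2 /cubic_sum mulr_suml.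
  rewrite exchange_big; apply: eq_bigr => x _ /=.
  under eq_bigr => c _ do rewrite mulr_sumr.
  by rewrite exchange_big.
have e (x : F) : \sum_y \sum_c s (c * x ^+ 3 + 1) * s (c * y ^+ 3 + 1)
   = 3 * q%:Z * (x != 0)%:R + q%:Z * (x == 0)%:R.
  under eq_bigr => y _ do rewrite sum_sigma_two_cubics.
  case: (eqVneq x 0) => [->|x0] /=.
    rewrite (bigD1 0) //= !eqxx sigma0 !mul0r !add0r big1 ?addr0 ?mulr0 ?add0r //.
    by move=> y /negPf->; rewrite !mul0r mulr0 addr0.
  transitivity (- s x * \sum_y s y + s x * q%:Z * \sum_y (y ^+ 3 == x ^+ 3)%:R * s y).
    rewrite !mulr_sumr -big_split; apply: eq_bigr => y _ /=.
    by rewrite mulr0 addr0; ring.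
  rewrite sum_sigma // sum_cube_eq // !sigmaM // sigma_cube_root_unity.
  transitivity (3 * q%:Z * s x ^+ 2 + q%:Z * 0); first by ring.
  by rewrite sqr_sigma x0.
rewrite (eq_bigr _ (fun x _ => e x)) big_split /= -!mulr_sumr.
rewrite [X in _ + _ * X](bigD1 0) //= eqxx [X in _ + _ * (_ + X)]big1; last by move=> x /negPf->.
rewrite (bigD1 0) //= eqxx add0r (eq_bigr (fun=> 1)); last by move=> x ->.
rewrite sumr_const cardC1 natz; have := card_gt1 F; case: q => // n _; lia.
Qed.

(** Grouping the second moment by classes modulo cubes, with c = 0 contributing q^2, gives 3 q^2 +
    (q - 1) X = 3 (q + 3 q (q - 1)) for the sum X of the three squares. *)
Lemma cubic_sum_sqr3 (z : F) : q.-1.-primitive_root z ->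
  cubic_sum 1 ^+ 2 + cubic_sum z ^+ 2 + cubic_sum (z ^+ 2) ^+ 2 = 6 * q%:Z.
Proof.
move=> zP; have := sum_over_cubes (fun c => cubic_sum c ^+ 2) zP.
rewrite sum_sqr_cubic_sum (bigD1 0) //= expr0n !mulr0 cubic_sum0.
rewrite (eq_bigr (fun=> cubic_sum 1 ^+ 2 + cubic_sum z ^+ 2 + cubic_sum (z ^+ 2) ^+ 2)); last first.
  by move=> x x0; rewrite !cubic_sumM // -[x ^+ 3]mul1r cubic_sumM.
rewrite sumr_const cardC1; move: (_ + _ ^+ 2) => X; rewrite -mulr_natl natz.
have := card_gt1 F; case: q => // n n1 e.
apply: (mulfI (_ : n%:Z != 0)); first by move: n1; case: n {e}.
by move: e => /=; lia.
Qed.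
End CubicSums.

(** * The sum over x^3 + 1 as twice the A of a representation q = A^2 + 3 B^2 *)

Section CubicSumValue.
Variable F : finFieldType.
Local Notation q := #|F|.
Local Notation s := (@sigma F).
Hypothesis q_odd : odd q.
Hypothesis q_mod3 : (3 %| q.-1)%N.

Lemma cubic_sum1_even : exists k : int, cubic_sum (1 : F) = 2 * k.
Proof.
have [w wE] := cube_root_unity_exists q_odd q_mod3.
(* Modulo 2 each term is 1, except at the three roots of x^3 = -1; hence the sum has the parity of q
   - 3. *)
have e (a : F) : s a = 1 - (a == 0)%:R - 2 * (s a == -1)%:R.
  by rewrite /sigma; case: (eqVneq a 0) => //= _; case: ifP.
rewrite /cubic_sum (eq_bigr _ (fun x _ => e _)) !sumrB -mulr_sumr.
have -> : \sum_(x : F) (1 * x ^+ 3 + 1 == 0)%:R = 3 :> int.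
  transitivity (\sum_(x : F) (x ^+ 3 == (-1) ^+ 3)%:R * (1 : int)).
    apply: eq_bigr => x _; rewrite mulr1; congr ((nat_of_bool _)%:R).
    by rewrite mul1r -[in RHS]subr_eq0; congr (_ == _); ring.
  by rewrite (sum_cube_eq q_odd q_mod3 wE) // oppr_eq0 oner_neq0.
rewrite sumr_const !natz -[#|xpredT|]/#|F|; move: (\sum__ _) => n.
have := odd_double_half q; rewrite q_odd => h; exists (q./2%:Z - 1 - n). lia.
Qed.

(** The term at 0 is 1. The others depend only on x^3, so along the powers of a primitive root they
    repeat with period (q - 1)/3, three times in all. *)
Lemma cubic_sum1_mod3 : exists k : int, cubic_sum (1 : F) = 1 + 3 * k.
Proof.
have [z zP] := primitive_root_exists F.
rewrite /cubic_sum (bigD1 0) //= expr0n mulr0 add0r sigma1.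
rewrite (sum_nonzero_primitive _ zP).
set r := (q.-1 %/ 3)%N; have h : (3 * r = q.-1)%N by rewrite mulnC divnK.
exists (\sum_(0 <= k < r) s (1 * (z ^+ k) ^+ 3 + 1)); congr (_ + _).
rewrite -[in LHS]h big_nat_mul (eq_bigr (fun=> \sum_(0 <= k < r) s (1 * (z ^+ k) ^+ 3 + 1))).
  by rewrite sumr_const_nat subn0 -[LHS]mulr_natl.
move=> i _; rewrite mulSn -{1}[(i * r)%N]add0n big_addn addnK.
apply: eq_bigr => k _; rewrite -!exprM mulnDl exprD.
by rewrite (_ : (i * r * 3 = q.-1 * i)%N) ?exprM ?(prim_expr_order zP) ?expr1n ?mulr1 // -h; lia.
Qed.

Lemma half_cubic_sum_norm : exists2 A : int, cubic_sum (1 : F) = 2 * A &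
  (A = -1 %[mod 3])%Z /\ exists B : int, q%:Z = A ^+ 2 + 3 * B ^+ 2.
Proof.
have [w wE] := cube_root_unity_exists q_odd q_mod3.
have [z zP] := primitive_root_exists F.
have [A eA] := cubic_sum1_even; have [k ek] := cubic_sum1_mod3.
exists A => //; split; first by lia.
have := cubic_sum_add3 q_odd zP; have := cubic_sum_sqr3 q_odd q_mod3 wE zP.
rewrite eA; move: (cubic_sum z) (cubic_sum (z ^+ 2)) => b c e2 e1.
(* Eliminate c by 2 A + b + c = 0 in (2 A)^2 + b^2 + c^2 = 6 q. The result makes b + A divisible by
   3, and the quotient serves as B. *)
have e3 : (b + A) ^+ 2 + 3 * A ^+ 2 = 3 * q%:Z.
  have ec : c = - 2 * A - b by move: e1; lia.
  have : 2 * ((b + A) ^+ 2 + 3 * A ^+ 2) = (2 * A) ^+ 2 + b ^+ 2 + c ^+ 2 by rewrite ec; ring.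
  by rewrite e2; lia.
have [n en] : exists n, b + A = 3 * n.
  have d : (3 %| (b + A) ^+ 2)%Z.
    apply/dvdzP; exists (q%:Z - A ^+ 2); lia.
  have : (3 %| b + A)%Z.
    move: d; by rewrite !dvdzE abszX Euclid_dvdX // => /andP[].
  by move=> /dvdzP[n ->]; exists n; rewrite mulrC.
by exists n; move: e3; rewrite en; lia.
Qed.
End CubicSumValue.

(** * Uniqueness of the normalised A, and identification of the cubic sum with 2 A_3 *)

Lemma A3_spec_unique (p : nat) (A A' : int) : prime p ->
  A3_spec p A -> A3_spec p A' -> A = A'.
Proof.
move=> p_pr [[B eB] mA] [[B' eB'] mA'].
have p_gt0 := prime_gt0 p_pr.
(* By the composition identity, p^2 = (A A' + 3 b b')^2 + 3 (A b' - A' b)^2. If p divides A b' - A'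
   b, that number is 0, since otherwise the last term is at least 3 p^2. *)
have cross (b b' : int) : p%:Z = A ^+ 2 + 3 * b ^+ 2 -> p%:Z = A' ^+ 2 + 3 * b' ^+ 2 ->
    (p%:Z %| A * b' - A' * b)%Z -> A ^+ 2 = A' ^+ 2.
  move=> e e' /dvdzP[k ek].
  have e1 : p%:Z ^+ 2 = (A * A' + 3 * b * b') ^+ 2 + 3 * (A * b' - A' * b) ^+ 2.
    rewrite expr2 {1}e e'; ring.
  have e2 : A * b' - A' * b = 0.
    rewrite ek; have [->|k0] := eqVneq k 0; first by rewrite mul0r.
    have k1 : 1 <= k ^+ 2 by rewrite -gtz0_ge1 exprn_even_gt0.
    have p2 : 0 < p%:Z ^+ 2 by rewrite exprn_gt0 // ltz_nat.
    have kp : 1 * p%:Z ^+ 2 <= k ^+ 2 * p%:Z ^+ 2 by rewrite ler_wpM2r ?sqr_ge0.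
    have S0 := sqr_ge0 (A * A' + 3 * b * b').
    move: e1; rewrite ek [(k * _) ^+ 2]exprMn => e1.
    have aux (S X P : int) : 0 <= S -> P = S + 3 * X -> 1 * P <= X -> 0 < P -> False by clear; lia.
    by case: (aux _ _ _ S0 e1 kp p2).
  have e3 : p%:Z * (b' ^+ 2 - b ^+ 2) = 0.
    rewrite mulrBr {1}e e'.
    have -> : (A ^+ 2 + 3 * b ^+ 2) * b' ^+ 2 - (A' ^+ 2 + 3 * b' ^+ 2) * b ^+ 2 =
      (A * b' - A' * b) * (A * b' + A' * b) by ring.
    by rewrite e2 mul0r.
  have : b' ^+ 2 - b ^+ 2 = 0.
    by move/eqP: e3; rewrite mulf_eq0 => /orP[/eqP|/eqP//]; move: p_gt0; clear; lia.
  move: (A ^+ 2) (A' ^+ 2) (b ^+ 2) (b' ^+ 2) e e'; clear; lia.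
have sq : A ^+ 2 = A' ^+ 2.
  (* The product is A^2 B'^2 - A'^2 B^2 = p (B'^2 - B^2); if p divides the second factor, [cross]
     applies after replacing B by -B. *)
  have : (p%:Z %| (A * B' - A' * B) * (A * B' + A' * B))%Z.
    apply/dvdzP; exists (B' ^+ 2 - B ^+ 2).
    transitivity (B' ^+ 2 * p%:Z - B ^+ 2 * p%:Z); last by ring.
    by rewrite {1}eB eB'; ring.
  rewrite dvdzE abszM /= Euclid_dvdM // => /orP[d|d].
    by apply: (cross B B').
  apply: (cross (- B) B'); rewrite ?sqrrN // dvdzE /=.
  by rewrite mulrN opprK.
by move/eqP: sq; rewrite eqf_sqr => /orP[/eqP|/eqP] //; move: mA mA'; clear; lia.
Qed.

Lemma cubic_sum_eq_A3 (F : finFieldType) : prime #|F| -> odd #|F| -> (3 %| #|F|.-1)%N ->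
  cubic_sum (1 : F) = 2 * A3 #|F|.
Proof.
move=> q_pr q_odd q_mod3; have [A -> [mA nA]] := half_cubic_sum_norm q_odd q_mod3.
congr (2 * _); apply: (A3_spec_unique q_pr); first by split.
(* Half the cubic sum is itself a witness, so the chosen [A3] satisfies its specification. *)
by apply: epsilon_spec; exists A; split.
Qed.

Lemma sum_pred1_int (T : finType) (a : T) : \sum_x (x == a)%:R = 1 :> int.
Proof. by rewrite (bigD1 a) //= eqxx big1 ?addr0 // => x /negPf->. Qed.

(** * Degrees in the Vieta graph, the number of vertices, and the vertices with one given coordinate
    fixed *)

Section VietaGraphCounts.
Variables (F : finFieldType) (C D : F).
Local Notation q := #|F|.
Local Notation s := (@sigma F).
Hypothesis q_odd : odd q.
Local Notation vertices := (vieta_vertices C D).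

(** The coordinate whose flip is tested comes first; the other two flips are treated by permuting
    the arguments. *)
Definition fixed1 (x y z : F) : bool := 2 * x == y * z - C.

Definition moved_count (v : F * F * F) : nat :=
  let: (x, y, z) := v in (~~ fixed1 x y z + ~~ fixed1 y x z + ~~ fixed1 z x y)%N.

Lemma flip_fixed (x y z : F) : (y * z - C - x == x) = fixed1 x y z.
Proof. by rewrite subr_eq /fixed1 eq_sym mulr_natl mulr2n. Qed.

Lemma vieta_flip_vertex (v u : F * F * F) :
  u \in vieta_flips C v -> v \in vertices -> u \in vertices.
Proof.
move: v u => [[x y] z] u; rewrite !inE => /or3P[] /eqP-> /= /eqP e; apply/eqP/eqP;
  rewrite -subr_eq0; move/eqP: e; rewrite -subr_eq0 => /eqP e; apply/eqP; rewrite -[RHS]e; ring.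
Qed.

Lemma vieta_flip_sym (v u : F * F * F) :
  u \in vieta_flips C v -> v \in vieta_flips C u.
Proof.
move: v u => [[x y] z] u; rewrite !inE => /or3P[] /eqP-> /=;
  by rewrite !inE subKr eqxx ?orbT.
Qed.

(** Flips are involutions preserving the surface, so the neighbours are the flips different from
    [v]; these are pairwise distinct because each changes another coordinate. *)
Lemma vieta_degreeE (v : F * F * F) : v \in vertices ->
  vieta_degree C D v = moved_count v.
Proof.
move=> vV; rewrite /vieta_degree.
have E : [set w | vieta_edge C D v w] =i [seq w <- vieta_flips C v | w != v].
  move=> w; rewrite inE mem_filter /vieta_edge vV /= eq_sym.
  case: (eqVneq w v) => [_|_] /=; first by rewrite andbF.
  apply/andP/idP => [[_ /orP[//|]]|h]; first exact: vieta_flip_sym.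
  by split; [apply: vieta_flip_vertex h vV | rewrite h].
rewrite (eq_card E) {E}; move: v {vV} => [[x y] z] /=.
rewrite !xpair_eqE !eqxx !andbT !andTb /= !flip_fixed.
case: ifP => h1; case: ifP => h2; case: ifP => h3.
all: rewrite ?cards0 ?card0 // (card_uniqP _) //= ?inE !xpair_eqE ?[_ == _ - _ - _]eq_sym.
all: by rewrite !flip_fixed ?(negPf h1) ?(negPf h2) ?(negPf h3) ?andbF.
Qed.

Lemma sum_triple (h : F -> F -> F -> int) :
  \sum_(v : F * F * F) h v.1.1 v.1.2 v.2 = \sum_x \sum_y \sum_z h x y z.
Proof. by rewrite pair_bigA pair_bigA. Qed.

Local Notation cubic x y z := (vieta_cubic C D (x, y, z)).

Lemma vieta_cubicC12 (x y z : F) : cubic y x z = cubic x y z.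
Proof. by rewrite /vieta_cubic; congr (_ == _); ring. Qed.

Lemma vieta_cubicC13 (x y z : F) : cubic z y x = cubic x y z.
Proof. by rewrite /vieta_cubic; congr (_ == _); ring. Qed.

(** The discriminant of [quad_disc x z] as a quadratic in z is 16 (x + 2) times this cubic. *)
Definition fiber_disc (x : F) : F := (x - 2) * (x ^+ 2 + C * x - D) + C ^+ 2.
Local Notation f := fiber_disc.

(** The discriminant in y of the surface equation, arranged by powers of z. *)
Definition quad_disc (x z : F) : F :=
  (x ^+ 2 - 4) * z ^+ 2 + (- 2 * C * (x + 2)) * z + (C ^+ 2 - 4 * (x ^+ 2 + C * x - D)).

Hypothesis C_neq0 : C != 0.

Lemma two_neqN2 : (2 : F) != - 2.
Proof. by rewrite -addr_eq0 (_ : 2 + 2 = 4) ?four_neq0 //; ring. Qed.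

Lemma sqrB4_eq0 (x : F) : (x ^+ 2 - 4 == 0) = (x == 2) || (x == - 2).
Proof. by rewrite (_ : x ^+ 2 - 4 = (x - 2) * (x + 2)) ?mulf_eq0 ?subr_eq0 ?addr_eq0 //; ring. Qed.

(** Over each (x, z) lie 1 + s ([quad_disc x z]) points; for fixed x the character is then summed
    over a quadratic in z. *)
Lemma card_vieta_vertices : #|vertices|%:Z =
  q%:Z ^+ 2 + 1 + q%:Z * (s (f (- 2)) + \sum_x (f x == 0)%:R * s (x ^+ 2 - 4)).
Proof.
have e1 (x z : F) : \sum_y (cubic x y z)%:R = 1 + s (quad_disc x z).
  transitivity (\sum_y (1 * y ^+ 2 + (C - x * z) * y +
    (x ^+ 2 + z ^+ 2 + C * (x + z) - D) == 0)%:R : int).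
    apply: eq_bigr => y _; congr (nat_of_bool _)%:R; rewrite /vieta_cubic -subr_eq0.
    by congr (_ == _); ring.
  by rewrite sum_quadratic_eq0 ?oner_neq0 //; congr (1 + s _); rewrite /quad_disc; ring.
have e2 (x : F) : \sum_z s (quad_disc x z) =
   - s (x ^+ 2 - 4) + q%:Z * ((f x == 0)%:R * s (x ^+ 2 - 4)) + q%:Z * s (f (- 2)) * (x == - 2)%:R.
  rewrite /quad_disc; case: (eqVneq (x ^+ 2 - 4) 0) => [e|xn0]; last first.
    rewrite sum_sigma_quadratic //.
    have -> : (- 2 * C * (x + 2)) ^+ 2 - 4 * (x ^+ 2 - 4) * (C ^+ 2 - 4 * (x ^+ 2 + C * x - D))
       = 4 * 4 * (x + 2) * f x by rewrite /f; ring.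
    move: xn0; rewrite sqrB4_eq0 negb_or => /andP[_ x2].
    rewrite !mulf_eq0 (addr_eq0 x) (negPf (four_neq0 q_odd)) (negPf x2) /=; ring.
  (* Degenerate fibres: at x = 2 the discriminant is linear in z with slope -8 C, so the sum is 0;
     at x = -2 it is the constant f (-2). *)
  rewrite e sigma0 mulr0 mulr0 oppr0 !add0r.
  move/eqP: e; rewrite sqrB4_eq0 => /orP[]/eqP->.
    rewrite (negPf two_neqN2) mulr0.
    under eq_bigr => z _ do rewrite mul0r add0r.
    rewrite sum_sigma_linear // mulf_neq0 //; last first.
      by rewrite (_ : 2 + 2 = 4) ?four_neq0 //; ring.
    by rewrite mulf_neq0 // oppr_eq0 two_neq0.
  rewrite eqxx mulr1; transitivity (\sum_(z : F) s (f (- 2))).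
    by apply: eq_bigr => z _; congr s; rewrite /f; ring.
  by rewrite sumr_const -[LHS]mulr_natl natz.
rewrite card_sum_int (eq_bigr (fun v : F * F * F => (cubic v.1.1 v.1.2 v.2)%:R));
  last by case=> [[]].
rewrite (sum_triple (fun x y z => (cubic x y z)%:R)).
transitivity (\sum_x \sum_z (1 + s (quad_disc x z))).
  apply: eq_bigr => x _; rewrite exchange_big; apply: eq_bigr => z _; exact: e1.
transitivity (\sum_x (q%:Z + \sum_z s (quad_disc x z))).
  by apply: eq_bigr => x _; rewrite big_split /= sumr_const natz.
rewrite big_split /= sumr_const (eq_bigr _ (fun x _ => e2 x)) !big_split /= sumrN -!mulr_sumr.
rewrite sum_sigma_sqrB // (negPf (four_neq0 q_odd)).
by rewrite sum_pred1_int !mulr1 mulr0 addr0 -[_ *+ _]mulr_natl natz -[#|xpredT|]/q; ring.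
Qed.

(** A point of the surface has x fixed exactly when x is a double root of its quadratic. So each
    zero (y, z) of [quad_disc] carries one such point. *)
Lemma card_fixed1 : f (- 2) != 0 ->
  \sum_x \sum_y \sum_z (cubic x y z && fixed1 x y z)%:R
  = q%:Z - 2 + \sum_y s ((y + 2) * f y).
Proof.
move=> fN2.
have e1 (y z : F) : \sum_x (cubic x y z && fixed1 x y z)%:R = (quad_disc y z == 0%R)%:R :> int.
  transitivity (\sum_(x : F) (quad_disc y z == 0%R)%:R * (2 * x + (C - y * z) == 0%R)%:R : int).
    apply: eq_bigr => x _; rewrite -natrM mulnb andbC [in RHS]andbC; congr (nat_of_bool _)%:R.
    rewrite /fixed1 -subr_eq0 (_ : 2 * x - (y * z - C) = 2 * x + (C - y * z)); last by ring.
    case: eqVneq => //= e; rewrite -subr_eq0.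
    rewrite -[RHS]oppr_eq0 -[LHS]orFb -(negPf (four_neq0 q_odd)) -mulf_eq0.
    congr (_ == _); transitivity ((2 * x + (C - y * z)) ^+ 2 - quad_disc y z).
      by rewrite /quad_disc; ring.
    by rewrite e expr0n add0r.
  by rewrite -mulr_sumr sum_linear_eq0 ?two_neq0 ?mulr1.
(* The generic count 1 + s (...) is one too large at y = 2, where the equation is linear but 4 f 2 =
   (2 C)^2 is a nonzero square, and at y = -2, where the constant f (-2) has no zero. *)
have e2 (y : F) : \sum_z (quad_disc y z == 0)%:R
   = 1 + s ((y + 2) * f y) - (y == 2)%:R - (y == - 2)%:R.
  rewrite /quad_disc; case: (eqVneq (y ^+ 2 - 4) 0) => [e|yn0]; last first.
    rewrite sum_quadratic_eq0 //.
    have -> : (- 2 * C * (y + 2)) ^+ 2 - 4 * (y ^+ 2 - 4) * (C ^+ 2 - 4 * (y ^+ 2 + C * y - D))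
       = 4 ^+ 2 * ((y + 2) * f y) by rewrite /f; ring.
    rewrite sigma_sqrM ?four_neq0 //.
    by move: yn0; rewrite sqrB4_eq0 negb_or => /andP[/negPf-> /negPf->]; rewrite !subr0.
  rewrite e; move/eqP: e; rewrite sqrB4_eq0 => /orP[]/eqP->.
    rewrite (negPf two_neqN2) eqxx.
    under eq_bigr => z _ do rewrite mul0r add0r.
    rewrite sum_linear_eq0; last first.
      rewrite !mulf_neq0 ?oppr_eq0 ?two_neq0 // (_ : 2 + 2 = 4) ?four_neq0 //; ring.
    rewrite (_ : (2 + 2) * f 2 = (2 * C) ^+ 2); last by rewrite /f; ring.
    by rewrite sigma_sqr ?mulf_neq0 ?two_neq0.
  rewrite eqxx eq_sym (negPf two_neqN2) addNr mul0r sigma0.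
  rewrite big1 // => z _.
  rewrite (_ : 0 * _ + _ + _ = f (- 2)); last by rewrite /f; ring.
  by rewrite (negPf fN2).
transitivity (\sum_y \sum_z (quad_disc y z == 0%R)%:R : int).
  rewrite exchange_big; apply: eq_bigr => y _ /=.
  rewrite exchange_big; apply: eq_bigr => z _; exact: e1.
rewrite (eq_bigr _ (fun y _ => e2 y)) !sumrB big_split /= sumr_const natz -[#|xpredT|]/q.
by rewrite !sum_pred1_int; ring.
Qed.
End VietaGraphCounts.

(** * Vertices with several fixed coordinates, and the count of each degree by inclusion and
    exclusion *)

Section DegreeCounts.
Variables (F : finFieldType) (C D : F).
Local Notation q := #|F|.
Local Notation s := (@sigma F).
Hypothesis q_odd : odd q.
Local Notation cubic x y z := (vieta_cubic C D (x, y, z)).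
Local Notation f := (fiber_disc C D).
Hypothesis C_neq0 : C != 0.
Hypothesis f_N2 : f (- 2) != 0.

Lemma fiber_disc2_neq0 : f 2 != 0.
Proof. by rewrite /fiber_disc subrr mul0r add0r expf_neq0. Qed.

(** The two fixedness equations differ by (z + 2) (x - y) = 0. The case z = -2 contradicts f (-2) !=
    0; otherwise x = y = C / (z - 2), and z - 2 times the surface equation becomes f z = 0. *)
Lemma fixed12E (x y z : F) :
  [&& cubic x y z, fixed1 C x y z & fixed1 C y x z]
  = [&& f z == 0, x == C / (z - 2) & y == C / (z - 2)].
Proof.
have two0 := two_neq0 q_odd; have four0 := four_neq0 q_odd.
have cubicE (u : F) : cubic u u z = (2 * u ^+ 2 + z ^+ 2 - u ^+ 2 * z + C * (2 * u + z) - D == 0).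
  by rewrite /vieta_cubic -subr_eq0; congr (_ == _); ring.
have key (u : F) : (z - 2) * u = C ->
    (z - 2) * (2 * u ^+ 2 + z ^+ 2 - u ^+ 2 * z + C * (2 * u + z) - D) = f z.
  by move=> e; rewrite /fiber_disc -e; ring.
apply/and3P/and3P => [[cu /eqP f1 /eqP f2]|[fz /eqP-> /eqP->]]; last first.
  (* The quotient C / (z - 2) is a genuine one, since f 2 = C^2 is nonzero. *)
  have z2 : z - 2 != 0.
    by rewrite subr_eq0; apply: contraTneq fz => ->; exact: fiber_disc2_neq0.
  have e : (z - 2) * (C / (z - 2)) = C by field.
  split; [|by rewrite /fixed1; apply/eqP; field|by rewrite /fixed1; apply/eqP; field].
  by rewrite cubicE -(inj_eq (mulfI z2)) key // mulr0.
have : (z + 2) * (x - y) = 0.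
  transitivity (2 * x - (y * z - C) - (2 * y - (x * z - C))); first by ring.
  by rewrite f1 f2; ring.
move/eqP; rewrite mulf_eq0 subr_eq0 => /orP[zN2|/eqP xy].
  have zE : z = - 2 by apply/eqP; rewrite -addr_eq0.
  case/negP: f_N2; apply/eqP.
  move: cu f1; rewrite zE /vieta_cubic => /eqP cu f1.
  (* With C eliminated, -f (-2) is four times the difference of the two sides of the cubic. *)
  have eC : C = - (2 * x + 2 * y) by rewrite f1; ring.
  apply: (mulfI (_ : - 1 != 0)); first by rewrite oppr_eq0 oner_neq0.
  rewrite mulr0 -(mulr0 4).
  transitivity (4 * (x ^+ 2 + y ^+ 2 + (- 2) ^+ 2 - (x * y * - 2 - C * (x + y - 2) + D))).
    by rewrite /fiber_disc eC; ring.
  by rewrite cu; ring.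
have e : (z - 2) * y = C 
  by have -> : C = y * z - 2 * x by [rewrite f1; ring]; rewrite xy; ring.
have z2 : z - 2 != 0.
  by apply: contraNneq C_neq0 => z2; rewrite -e z2 mul0r.
have yE : y = C / (z - 2) by rewrite -e; field.
split; rewrite ?xy -?yE //.
by rewrite -(key y) // mulf_eq0 -cubicE -{1}xy cu orbT.
Qed.

Lemma card_fixed12 : \sum_x \sum_y \sum_z
  [&& cubic x y z, fixed1 C x y z & fixed1 C y x z]%:R = \sum_z (f z == 0)%:R :> int.
Proof.
transitivity (\sum_z \sum_x \sum_y [&& f z == 0%R, x == C / (z - 2) & y == C / (z - 2)]%:R : int).
  rewrite exchange_big.
  under eq_bigr => y _ do rewrite exchange_big.
  rewrite exchange_big; apply: eq_bigr => z _; rewrite exchange_big.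
  by apply: eq_bigr => x _; apply: eq_bigr => y _; rewrite fixed12E.
apply: eq_bigr => z _.
transitivity (\sum_x (f z == 0%R)%:R * (x == C / (z - 2))%:R : int).
  apply: eq_bigr => x _.
  transitivity (\sum_y ((f z == 0%R) && (x == C / (z - 2)))%:R * (y == C / (z - 2))%:R : int).
    by apply: eq_bigr => y _; rewrite -natrM mulnb andbA.
  by rewrite -mulr_sumr sum_pred1_int mulr1 -mulnb natrM.
by rewrite -mulr_sumr sum_pred1_int mulr1.
Qed.

Hypothesis f_critical : forall x, x * (x - 2) = C -> f x != 0.

(** Applying [fixed12E] to two pairs of coordinates forces x = y = z, with x (x - 2) = C and f x =
    0, which [f_critical] excludes. *)
Lemma fixed123F (x y z : F) :
  [&& cubic x y z, fixed1 C x y z, fixed1 C y x z & fixed1 C z x y] = false.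
Proof.
apply/negP => /and4P[cu f1 f2 f3].
have := fixed12E x y z; rewrite cu f1 f2 /= => /esym /and3P[fz /eqP ex /eqP ey].
have fx1 u v w : fixed1 C u v w = fixed1 C u w v by rewrite /fixed1 (mulrC v).
have := fixed12E z y x; rewrite vieta_cubicC13 cu fx1 f3 fx1 f2 /=.
move=> /esym /and3P[fx /eqP ez /eqP ey'].
have xz : x = z by rewrite ex -ey ey' -ez.
have x2 : x - 2 != 0.
  by rewrite subr_eq0; apply: contraTneq fx => ->; exact: fiber_disc2_neq0.
suff : f x != 0 by rewrite fx.
by apply: f_critical; rewrite {1}xz ez; field.
Qed.

Lemma sum_swap12 (a b : F -> F -> F -> int) : (forall x y z, a x y z = b y x z) ->
  \sum_x \sum_y \sum_z a x y z = \sum_x \sum_y \sum_z b x y z.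
Proof.
move=> e; rewrite exchange_big.
by apply: eq_bigr => x _; apply: eq_bigr => y _; apply: eq_bigr => z _; rewrite e.
Qed.

Lemma sum_swap23 (a b : F -> F -> F -> int) : (forall x y z, a x y z = b x z y) ->
  \sum_x \sum_y \sum_z a x y z = \sum_x \sum_y \sum_z b x y z.
Proof.
move=> e; apply: eq_bigr => x _; rewrite exchange_big.
by apply: eq_bigr => y _; apply: eq_bigr => z _; rewrite e.
Qed.

Lemma fixed1C (u v w : F) : fixed1 C u v w = fixed1 C u w v.
Proof. by rewrite /fixed1 (mulrC v). Qed.

(** [E] is the number of vertices with one given coordinate fixed, [P] the number with two given
    coordinates fixed. *)
Let E := q%:Z - 2 + \sum_y s ((y + 2) * f y).
Let P : int := \sum_z (f z == 0)%:R.

Let a1 x y z : int := (cubic x y z && fixed1 C x y z)%:R.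
Let a2 x y z : int := (cubic x y z && fixed1 C y x z)%:R.
Let a3 x y z : int := (cubic x y z && fixed1 C z x y)%:R.
Let b12 x y z : int := [&& cubic x y z, fixed1 C x y z & fixed1 C y x z]%:R.
Let b13 x y z : int := [&& cubic x y z, fixed1 C x y z & fixed1 C z x y]%:R.
Let b23 x y z : int := [&& cubic x y z, fixed1 C y x z & fixed1 C z x y]%:R.

Lemma vieta_cubicC23 (x y z : F) : cubic x z y = cubic x y z.
Proof. by rewrite /vieta_cubic; congr (_ == _); ring. Qed.

Lemma sum_fixed_one :
  \sum_x \sum_y \sum_z (a1 x y z + a2 x y z + a3 x y z) = 3 * E.
Proof.
have e1 : \sum_x \sum_y \sum_z a1 x y z = E by apply: card_fixed1.
have e2 : \sum_x \sum_y \sum_z a2 x y z = E.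
  by rewrite -e1; apply: sum_swap12 => x y z; rewrite /a1 /a2 vieta_cubicC12.
have e3 : \sum_x \sum_y \sum_z a3 x y z = E.
  by rewrite -e2; apply: sum_swap23 => x y z; rewrite /a3 /a2 vieta_cubicC23.
transitivity (\sum_x \sum_y \sum_z a1 x y z + \sum_x \sum_y \sum_z a2 x y z
   + \sum_x \sum_y \sum_z a3 x y z); last by rewrite e1 e2 e3; ring.
rewrite -!big_split; apply: eq_bigr => x _; rewrite -!big_split; apply: eq_bigr => y _.
by rewrite -!big_split.
Qed.

Lemma sum_fixed_two :
  \sum_x \sum_y \sum_z (b12 x y z + b13 x y z + b23 x y z) = 3 * P.
Proof.
have e1 : \sum_x \sum_y \sum_z b12 x y z = P by apply: card_fixed12.
have e2 : \sum_x \sum_y \sum_z b13 x y z = P.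
  rewrite -e1; apply: sum_swap23 => x y z.
  by rewrite /b12 /b13 vieta_cubicC23 (fixed1C x).
have e3 : \sum_x \sum_y \sum_z b23 x y z = P.
  rewrite -e2; apply: sum_swap12 => x y z.
  by rewrite /b23 /b13 vieta_cubicC12 (fixed1C z).
transitivity (\sum_x \sum_y \sum_z b12 x y z + \sum_x \sum_y \sum_z b13 x y z
   + \sum_x \sum_y \sum_z b23 x y z); last by rewrite e1 e2 e3; ring.
rewrite -!big_split; apply: eq_bigr => x _; rewrite -!big_split; apply: eq_bigr => y _.
by rewrite -!big_split.
Qed.

(** At a vertex with k fixed coordinates the a's sum to k and the b's to k (k - 1)/2. As k is at
    most 2 by [fixed123F], suitable i and j reproduce the indicator of any condition on the degree
    that fails at degree 3. *)
Lemma card_vertices_moved (Q : pred nat) (i j : int) :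
  (forall x y z, cubic x y z ->
     (Q (moved_count C (x, y, z)))%:R =
     i * (a1 x y z + a2 x y z + a3 x y z) + j * (b12 x y z + b13 x y z + b23 x y z)) ->
  #|[set v in vieta_vertices C D | Q (vieta_degree C D v)]|%:Z = i * (3 * E) + j * (3 * P).
Proof.
move=> h; rewrite card_sum_int -sum_fixed_one -sum_fixed_two.
rewrite !mulr_sumr -big_split.
transitivity (\sum_x \sum_y \sum_z (i * (a1 x y z + a2 x y z + a3 x y z)
   + j * (b12 x y z + b13 x y z + b23 x y z))); last first.
  apply: eq_bigr => x _; rewrite /= !mulr_sumr -big_split; apply: eq_bigr => y _ /=.
  by rewrite !mulr_sumr -big_split.
rewrite -sum_triple; apply: eq_bigr => [[[x y] z]] _.
have vE : ((x, y, z) \in vieta_vertices C D) = cubic x y z by rewrite inE.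
have := h x y z; rewrite /a1 /a2 /a3 /b12 /b13 /b23.
rewrite -!vE; case vV: (_ \in vieta_vertices C D); last by rewrite !mulr0.
by move=> /(_ isT) <-; rewrite vieta_degreeE.
Qed.

Lemma card_vieta_degree0 : #|vieta_of_degree C D 0| = 0%N.
Proof.
suff : #|vieta_of_degree C D 0|%:Z = 0 by case.
rewrite (@card_vertices_moved (eq_op^~ 0%N) 0 0) ?mul0r // => x y z c.
have := fixed123F x y z; rewrite /a1 /a2 /a3 /b12 /b13 /b23 c /=.
by do 3 case: (fixed1 _ _ _ _).
Qed.

Lemma card_vieta_degree1 : #|vieta_of_degree C D 1|%:Z = 3 * P.
Proof.
rewrite (@card_vertices_moved (eq_op^~ 1%N) 0 1) ?mul0r ?mul1r ?add0r // => x y z c.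
have := fixed123F x y z; rewrite /a1 /a2 /a3 /b12 /b13 /b23 c /=.
by do 3 case: (fixed1 _ _ _ _).
Qed.

Lemma card_vieta_degree2 : #|vieta_of_degree C D 2|%:Z = 3 * E - 6 * P.
Proof.
rewrite (@card_vertices_moved (eq_op^~ 2%N) 1 (- 2)) => [|x y z c]; first by ring.
have := fixed123F x y z; rewrite /a1 /a2 /a3 /b12 /b13 /b23 c /=.
by do 3 case: (fixed1 _ _ _ _).
Qed.

Lemma card_vieta_deficient : #|vieta_deficient C D|%:Z = 3 * E - 3 * P.
Proof.
rewrite (@card_vertices_moved (fun k => k < 3)%N 1 (- 1)) => [|x y z c]; first by ring.
have := fixed123F x y z; rewrite /a1 /a2 /a3 /b12 /b13 /b23 c /=.
by do 3 case: (fixed1 _ _ _ _).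
Qed.
End DegreeCounts.

(** * The surfaces of the theorem in terms of t = T^3: roots and character sums of f *)

Section CubeParameter.
Variables (F : finFieldType) (T : F).
Local Notation q := #|F|.
Local Notation s := (@sigma F).
Local Notation t := (T ^+ 3).
Hypothesis q_odd : odd q.
Hypothesis q_mod3 : (3 %| q.-1)%N.
Hypothesis T_neq0 : T != 0.
Hypothesis t_neq1 : t - 1 != 0.
Hypothesis t_neq4 : 4 * t - 1 != 0.
Hypothesis C_num_neq0 : 8 * t ^+ 2 + 20 * t - 1 != 0.

(** This solves (J + 1)/(J - 2) = t. Since J + 2 = (4 t - 1)/(t - 1) and C has numerator 8 t^2 + 20
    t - 1, the last two hypotheses say J != -2 and C != 0. Below, m = -3 (J + 2). *)
Let J := (2 * t + 1) / (t - 1).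
Let C := 3 * J ^+ 2 - 4.
Let D := 9 * J ^+ 3 - 36 * J - 28.
Local Notation f := (fiber_disc C D).
Let m := - 3 * (4 * t - 1) / (t - 1).

Let three0 : (3 : F) != 0. Proof. exact: three_neq0. Qed.

Lemma param_CE : C = (8 * t ^+ 2 + 20 * t - 1) / (t - 1) ^+ 2.
Proof. by rewrite /C /J; field. Qed.

Lemma param_C_neq0 : C != 0.
Proof. by rewrite param_CE mulf_neq0 // invr_neq0 // expf_neq0. Qed.

Lemma fiber_disc_cubes (x : F) : f x * (t - 1) = (x + 2) ^+ 3 * t - (x + 2 + m) ^+ 3.
Proof. by rewrite /fiber_disc /m /C /D /J; field. Qed.

(** The inverse of x |-> w = (x + 2 + m)/(x + 2). The convention 1/0 = 0 sends w = 1 to x = -2, the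
    one value otherwise missed, so this is a permutation of the field and sums can be reindexed by
    it. *)
Definition root_param (w : F) : F := - 2 + m / (w - 1).
Local Notation phi := root_param.

Lemma param_m_neq0 : m != 0.
Proof. by rewrite /m !mulf_neq0 ?invr_neq0 ?oppr_eq0. Qed.

Lemma root_param_inj : injective phi.
Proof.
by move=> x y /addrI /(mulfI param_m_neq0) /invr_inj /addIr.
Qed.

Lemma fiber_disc_param (w : F) : w != 1 ->
  f (phi w) = (m / (w - 1)) ^+ 3 * (t - w ^+ 3) / (t - 1).
Proof.
rewrite -subr_eq0 => w1; apply: (mulIf t_neq1); rewrite fiber_disc_cubes /phi.
by field; rewrite t_neq1 w1.
Qed.

Lemma fiber_discN2 : f (- 2) = (3 * (4 * t - 1) / (t - 1) ^+ 2) ^+ 2 * (3 * (4 * t - 1)).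
Proof.
by apply: (mulIf t_neq1); rewrite fiber_disc_cubes /m; field.
Qed.

Lemma fiber_discN2_neq0 : f (- 2) != 0.
Proof.
by rewrite fiber_discN2 !(mulf_neq0, expf_neq0, invr_neq0).
Qed.

Lemma root_param1 : phi 1 = - 2.
Proof. by rewrite /phi subrr invr0 mulr0 addr0. Qed.

Lemma fiber_disc_param_eq0 (w : F) : (f (phi w) == 0) = (w ^+ 3 == t).
Proof.
have [->|w1] := eqVneq w 1.
  rewrite root_param1 (negPf fiber_discN2_neq0) expr1n eq_sym.
  by rewrite -subr_eq0 (negPf t_neq1).
have w10 : w - 1 != 0 by rewrite subr_eq0.
have u0 : (m / (w - 1)) ^+ 3 != 0 by rewrite expf_neq0 // mulf_neq0 ?invr_neq0 ?param_m_neq0.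
rewrite fiber_disc_param // mulf_eq0 invr_eq0 (negPf t_neq1) orbF.
by rewrite mulf_eq0 (negPf u0) /= subr_eq0 eq_sym.
Qed.

Lemma sum_roots (h : F -> int) :
  \sum_x (f x == 0)%:R * h x = \sum_w (w ^+ 3 == t)%:R * h (phi w).
Proof.
rewrite (reindex_inj root_param_inj) /=.
by apply: eq_bigr => w _; rewrite fiber_disc_param_eq0.
Qed.

Lemma card_roots : \sum_x (f x == 0)%:R = 3 :> int.
Proof.
have [w wE] := cube_root_unity_exists q_odd q_mod3.
transitivity (\sum_x (f x == 0)%R%:R * 1 : int).
  by apply: eq_bigr => x _; rewrite mulr1.
by rewrite sum_roots (sum_cube_eq q_odd q_mod3 wE).
Qed.

(** For a primitive cube root of unity w, (2 w + 1)^2 = -3. *)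
Lemma sigmaN3 : s (- 3) = 1.
Proof.
have [w wE] := cube_root_unity_exists q_odd q_mod3.
have e : (2 * w + 1) ^+ 2 = - 3.
  transitivity (4 * (w ^+ 2 + w + 1) - 3); first by ring.
  by rewrite wE; ring.
by rewrite -e sigma_sqr // -sqrf_eq0 e oppr_eq0.
Qed.

Lemma sigma_three_mul (a : F) : s (3 * (a - 1)) = s (1 - a).
Proof. by rewrite (_ : 3 * (a - 1) = - 3 * (1 - a)) ?sigmaM // ?sigmaN3 ?mul1r //; ring. Qed.

Lemma sigma_fiber_discN2 : s (f (- 2)) = s (1 - 4 * t).
Proof.
rewrite fiber_discN2 sigma_sqrM ?sigma_three_mul //.
by rewrite !(mulf_neq0, expf_neq0, invr_neq0).
Qed.

(** The first factor is the one squared in [root_paramB2]; C != 0 keeps it from vanishing. *)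
Lemma C_num_factor (w : F) : w ^+ 3 = t -> 8 * t ^+ 2 + 20 * t - 1 =
  (2 * w ^+ 2 + 2 * w - 1) * (4 * w ^+ 4 - 4 * w ^+ 3 + 6 * w ^+ 2 + 2 * w + 1).
Proof. by move=> <-; ring. Qed.

Lemma cube_neq1 (w : F) : w ^+ 3 = t -> w - 1 != 0.
Proof.
move=> e; rewrite subr_eq0; apply: contraNneq t_neq1 => w1.
by rewrite -e w1 expr1n subrr.
Qed.

Lemma root_paramB2 (w : F) : w ^+ 3 = t ->
  phi w - 2 = - (2 * w ^+ 2 + 2 * w - 1) ^+ 2 / ((t - 1) * (w - 1)).
Proof.
move=> e; have w1 := cube_neq1 e; have := t_neq1.
by rewrite /phi /m -e => t1; field; rewrite t1 w1.
Qed.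

(** At each of the three roots x, (x - 2) (x + 2) is a nonzero square times 3 (4 t - 1), and -3 is a
    square. *)
Lemma sum_sigma_roots : \sum_x (f x == 0)%:R * s (x ^+ 2 - 4) = 3 * s (1 - 4 * t).
Proof.
have [z zE] := cube_root_unity_exists q_odd q_mod3.
rewrite sum_roots.
transitivity (\sum_w (w ^+ 3 == t)%:R * s (1 - 4 * t)); last first.
  by rewrite (sum_cube_eq q_odd q_mod3 zE (fun=> s (1 - 4 * t))) //; ring.
apply: eq_bigr => w _; case: eqP => [e|_]; last by rewrite !mul0r.
have w1 := cube_neq1 e.
have g0 : 2 * w ^+ 2 + 2 * w - 1 != 0.
  by move: C_num_neq0; rewrite (C_num_factor e) mulf_eq0 negb_or => /andP[].
congr (_ * _).
have -> : phi w ^+ 2 - 4 = (phi w - 2) * (phi w + 2) by ring.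
rewrite root_paramB2 // -[RHS]sigma_three_mul.
rewrite -[RHS](@sigma_sqrM _ q_odd ((2 * w ^+ 2 + 2 * w - 1) / ((t - 1) * (w - 1)))).
  by congr s; rewrite /phi /m; field; rewrite t_neq1 w1.
by rewrite !(mulf_neq0, expf_neq0, invr_neq0).
Qed.

Lemma sum_sigma_fiber : \sum_y s ((y + 2) * f y) = s (T ^+ 4 - T) * cubic_sum (1 : F) - 1.
Proof.
rewrite (reindex_inj root_param_inj) /=.
(* Up to squares (x + 2) f x is (t - 1) (t - w^3). At w = 1 the former is 0 while the latter is a
   nonzero square, whence the correction. *)
transitivity (\sum_w (s (t - 1) * s (t - w ^+ 3) - (w == 1)%:R)).
  apply: eq_bigr => w _; have [->|w1] := eqVneq w 1.
    by rewrite root_param1 addNr mul0r sigma0 expr1n -sigmaM // -expr2 sigma_sqr //.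
  have w10 : w - 1 != 0 by rewrite subr_eq0.
  rewrite subr0 fiber_disc_param // -sigmaM //.
  have u0 : (m / (w - 1)) ^+ 2 / (t - 1) != 0.
    by rewrite mulf_neq0 ?invr_neq0 // expf_neq0 // mulf_neq0 ?invr_neq0 // param_m_neq0.
  rewrite -[RHS](sigma_sqrM q_odd _ u0); congr s; rewrite /phi.
  by field; rewrite t_neq1 w10.
rewrite sumrB sum_pred1_int -mulr_sumr; congr (_ - 1).
have NT0 : - T != 0 by rewrite oppr_eq0.
(* With w = -T v, (t - 1) (t - w^3) becomes T^2 (T^4 - T) (v^3 + 1). *)
rewrite (reindex_inj (mulfI NT0)) /= /cubic_sum !mulr_sumr.
apply: eq_bigr => v _; rewrite -!sigmaM // -[RHS](sigma_sqrM q_odd _ T_neq0).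
by congr s; ring.
Qed.

Lemma param_f_critical (x : F) : x * (x - 2) = C -> f x != 0.
Proof.
move=> xC; apply/negP => fx.
have [w xE] : exists w, x = phi w.
  by exists (invF root_param_inj x); rewrite f_invF.
move: fx xC; rewrite xE fiber_disc_param_eq0 => /eqP e.
have w1 := cube_neq1 e.
have g0 : 2 * w ^+ 2 + 2 * w - 1 != 0.
  by move: C_num_neq0; rewrite (C_num_factor e) mulf_eq0 negb_or => /andP[].
have w0 : w != 0.
  by apply: contraNneq (expf_neq0 3 T_neq0) => w0; rewrite -e w0 expr0n.
rewrite root_paramB2 // param_CE (C_num_factor e) => h.
have d0 : (t - 1) ^+ 2 * (w - 1) ^+ 2 != 0 by rewrite mulf_neq0 ?expf_neq0.
(* Clearing denominators in x (x - 2) = C at the root x given by w leaves this product, none of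
   whose factors vanishes. *)
have : (2 * w ^+ 2 + 2 * w - 1) * (3 ^+ 2 * w ^+ 2 * (4 * t - 1)) = 0.
  transitivity ((phi w * (- (2 * w ^+ 2 + 2 * w - 1) ^+ 2 / ((t - 1) * (w - 1))) - 
     (2 * w ^+ 2 + 2 * w - 1) * (4 * w ^+ 4 - 4 * w ^+ 3 + 6 * w ^+ 2 + 2 * w + 1) / (t - 1) ^+ 2)
     * ((t - 1) ^+ 2 * (w - 1) ^+ 2)).
    have := t_neq1; rewrite /phi /m -e => t1; field; by rewrite t1 w1.
  by rewrite h subrr mul0r.
by apply/eqP; rewrite !mulf_neq0 ?expf_neq0.
Qed.

(** Here [P] = 3 and [E] = q - 3 + 2 s (T^4 - T) A_3; the two values 1 and 3 of the terms in s (1 -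
    4 t) add to the coefficient 4. *)
Lemma vieta_graph_counts : prime q ->
  [/\ #|vieta_vertices C D|%:Z = q%:Z ^+ 2 + 1 + 4 * s (1 - 4 * t) * q%:Z,
      #|vieta_deficient C D|%:Z = 3 * (q%:Z - 6 + 2 * s (T ^+ 4 - T) * A3 q),
      #|vieta_of_degree C D 2|%:Z = 3 * (q%:Z - 9 + 2 * s (T ^+ 4 - T) * A3 q),
      #|vieta_of_degree C D 1| = 9%N
    & #|vieta_of_degree C D 0| = 0%N].
Proof.
move=> q_pr; have C0 := param_C_neq0; have fN2 := fiber_discN2_neq0.
have crit := param_f_critical.
split.
- rewrite card_vieta_vertices // sigma_fiber_discN2 sum_sigma_roots; ring.
- rewrite card_vieta_deficient // card_roots sum_sigma_fiber cubic_sum_eq_A3 //; ring.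
- rewrite card_vieta_degree2 // card_roots sum_sigma_fiber cubic_sum_eq_A3 //; ring.
- by have := card_vieta_degree1 q_odd C0 fN2 crit; rewrite card_roots => -[].
- exact: card_vieta_degree0.
Qed.
End CubeParameter.

(** * Transfer of the conditions on J to conditions on t = T^3 *)

Theorem theorem14p3 (p : nat) (p_prime : prime p) (p_ge5 : (5 <= p)%N)
  (p_mod3 : p = 1 %[mod 3]) (J T : 'F_p)
  (J_neq2 : J <> 2) (J_neqN2 : J <> -2) (J_neqN1 : J <> -1)
  (J2_neq : J ^+ 2 <> 4 / 3)
  (T_neq0 : T <> 0) (JT : (J + 1) / (J - 2) = T ^+ 3) :
  let C : 'F_p := 3 * J ^+ 2 - 4 in
  let D : 'F_p := 9 * J ^+ 3 - 36 * J - 28 in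
  [/\ #|vieta_vertices C D|%:Z
        = p%:Z ^+ 2 + 1 + 4 * sigma (1 - 4 * T ^+ 3) * p%:Z,
      #|vieta_deficient C D|%:Z
        = 3 * (p%:Z - 6 + 2 * sigma (T ^+ 4 - T) * A3 p),
      #|vieta_of_degree C D 2|%:Z
        = 3 * (p%:Z - 9 + 2 * sigma (T ^+ 4 - T) * A3 p),
      #|vieta_of_degree C D 1| = 9%N
    & #|vieta_of_degree C D 0| = 0%N].
Proof.
move=> C D.
have cF : #|'F_p| = p by rewrite card_Fp.
have q_odd : odd #|'F_p| by rewrite cF; case/even_prime: p_prime => // p2; move: p_ge5; rewrite p2.
have q_mod3 : (3 %| #|'F_p|.-1)%N.
  rewrite cF; have h : p.-1.+1 = p by rewrite prednK // prime_gt0.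
  by rewrite /dvdn; apply/eqP; move: p_mod3 h; lia.
have J2 : J - 2 != 0 by rewrite subr_eq0; apply/eqP.
have three0 : (3 : 'F_p) != 0 by apply: three_neq0.
have T0 : T != 0 by apply/eqP.
have e : J + 1 = T ^+ 3 * (J - 2) by rewrite -JT divfK.
(* If t = 1 then J + 1 = J - 2, that is 3 = 0. *)
have t1 : T ^+ 3 - 1 != 0.
  apply: contraNneq three0 => t1.
  by rewrite (_ : 3 = J + 1 - (J - 2)); [rewrite e -{2}[J - 2]mul1r -mulrBl t1 mul0r|ring].
have eJ : J = (2 * T ^+ 3 + 1) / (T ^+ 3 - 1).
  apply: (mulIf t1); rewrite divfK // mulrBr mulr1.
  have -> : J * T ^+ 3 = T ^+ 3 * (J - 2) + 2 * T ^+ 3 by ring.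
  by rewrite -e; ring.
(* From 4 t = 1 follows 2 t + 1 = -2 (t - 1), that is J = -2. *)
have t4 : 4 * T ^+ 3 - 1 != 0.
  apply/eqP => t4; apply: J_neqN2; rewrite eJ.
  apply: (mulIf t1); rewrite divfK //.
  by apply/eqP; rewrite -subr_eq0 -t4; apply/eqP; ring.
have Cn : 8 * (T ^+ 3) ^+ 2 + 20 * T ^+ 3 - 1 != 0.
  apply/eqP => Cn; apply: J2_neq; apply: (mulIf three0); rewrite divfK //.
  apply: (mulIf (expf_neq0 2 t1)); apply/eqP; rewrite -subr_eq0; apply/eqP.
  by rewrite -[RHS]Cn eJ; field.
have := vieta_graph_counts q_odd q_mod3 T0 t1 t4 Cn.
by rewrite -eJ !cF; apply.
Qed.
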